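(* For all integers $r,t$ with $3\le t\le r$, \[ f_t(r,r)=\rho_t\big(T(r+1,r)\big)=\frac{1}{r+1}\Big(\binom{r+1}{t}-\binom{r-1}{t-2}\Big), \] where $T(r+1,r)$ is $K_{r+1}$ with one edge removed.
   Context: $\mathcal{G}(\Delta,\omega)$ denotes the class of finite simple graphs $G$ with maximum degree $\Delta(G)\le\Delta$ and clique number $\omega(G)\le\omega$. $k_t(G)$ is the number of copies of $K_t$ in $G$ and $\rho_t(G)=k_t(G)/|V(G)|$. $f_t(\Delta,\omega)=\sup\{\rho_t(G): G\in\mathcal{G}(\Delta,\omega),\ |V(G)|\ge 1\}$. $T(n,r)$ denotes the $r$-partite Turán graph on $n$ vertices. *)

(* Defs.v *)
From HB Require Import structures.
From mathcomp Require Import all_boot all_order all_algebra.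
Set Implicit Arguments. Unset Strict Implicit. Unset Printing Implicit Defensive.
Import Order.TTheory GRing.Theory Num.Theory.

Definition simple_graph (V : finType) (e : rel V) : Prop :=
  symmetric e /\ irreflexive e.

Definition is_clique (V : finType) (e : rel V) (S : {set V}) : bool :=
  [forall x in S, forall y in S, (x != y) ==> e x y].

Definition k_t (t : nat) (V : finType) (e : rel V) : nat :=
  #|[set S : {set V} | is_clique e S && (#|S| == t)]|.

Definition rho_t (t : nat) (V : finType) (e : rel V) : rat :=
  ((k_t t e)%:R / #|V|%:R)%R.

Definition max_deg_le (V : finType) (e : rel V) (D : nat) : bool :=
  [forall v, #|[set u | e v u]| <= D].

Definition clique_num_le (V : finType) (e : rel V) (w : nat) : bool :=
  [forall S : {set V}, is_clique e S ==> (#|S| <= w)].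

Definition in_class (V : finType) (e : rel V) (D w : nat) : Prop :=
  simple_graph e /\ max_deg_le e D /\ clique_num_le e w.

Definition is_f_t (t D w : nat) (x : rat) : Prop :=
  (forall (V : finType) (e : rel V), in_class e D w -> 0 < #|V| ->
      (rho_t t e <= x)%R) /\
  (forall y : rat,
      (forall (V : finType) (e : rel V), in_class e D w -> 0 < #|V| ->
          (rho_t t e <= y)%R) -> (x <= y)%R).

Definition turan_rel (n r : nat) : rel 'I_n :=
  fun i j => (i != j) && (i %% r != j %% r).
Arguments turan_rel : clear implicits.

(* Main.v *)
(* Count the [t]-cliques through a vertex [v] as the [(t-1)]-cliques of its
   neighbourhood, and let a missing pair of [v] be a nonadjacent pair of
   neighbours.  A vertex of degree [r] has a missing pair, for otherwise its closed
   neighbourhood is a [K_(r+1)].  If it has exactly one, every clique of size at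
   least 3 meeting the closed neighbourhood lies inside it; this set spans
   [K_(r+1)] minus an edge, so it can be deleted and induction applies.  If no
   such vertex remains, every vertex has degree less than [r] or at least two
   missing pairs, and for [4 <= t] or [r <= 5] it lies on few enough [t]-cliques
   by itself.  For [t = 3] and [6 <= r] the vertices with exactly two missing pairs
   exceed the average, and are compensated by a neighbour of small count. *)

Require Import Defs.
From HB Require Import structures.
From mathcomp Require Import all_boot all_order all_algebra.
From mathcomp Require Import zify ring.
Import Order.TTheory GRing.Theory Num.Theory.

(** * Binomial estimates for [turan_count], the number of [t]-cliques of [K_(r+1)] minus an edge *)

Definition turan_count r t := 'C(r.+1, t) - 'C(r.-1, t - 2).

(** Absorption, [t * 'C(r.+1, t) = r.+1 * 'C(r, t.-1)]. Pascal's rule makes the subtracted binomial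
    a summand of ['C(r.+1, t)], so the truncated subtraction is exact. *)
Lemma mul_turan_count r t : 3 <= t -> t <= r ->
  t * turan_count r t + t * 'C(r.-1, t - 2) = r.+1 * 'C(r, t.-1).
Proof.
case: t r => [|[|[|t]]] // [|[|[|r]]] // _ tr.
rewrite /turan_count !subSS subn0 /=.
have -> : 'C(r.+4, t.+3) = 'C(r.+3, t.+3) + 'C(r.+2, t.+2) + 'C(r.+2, t.+1).
  by rewrite [LHS]binS [in X in _ + X]binS addnA.
rewrite addnK -mulnDr [RHS]mul_bin_diag; congr (_ * _).
by rewrite [RHS]binS [in X in _ = _ + X]binS addnA.
Qed.

(** By Pascal's rule on ['C(r, t.-1)], the two sides differ by [(r.+1 - t) * 'C(r.-1, t - 2)]. *)
Lemma low_degree_bound r t : 3 <= t -> t <= r ->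
  r.+1 * 'C(r.-1, t.-1) <= t * turan_count r t.
Proof.
move=> t3 tr; have := mul_turan_count r t t3 tr.
case: t r t3 tr => [|[|[|t]]] // [|[|[|r]]] // _ tr.
rewrite !subSS subn0 /= [in X in _ = X -> _]binS; nia.
Qed.

Lemma two_missing_bound r t w : 3 <= t -> t <= r -> (4 <= t) || (r <= 5) ->
  w + 'C(r - 2, t.-1 - 2) + 'C(r - 3, t.-1 - 2) <= 'C(r, t.-1) ->
  r.+1 * w <= t * turan_count r t.
Proof.
move=> t3 tr; have := mul_turan_count r t t3 tr.
case: t r t3 tr => [|[|[|t]]] // [|[|[|r]]] // _ tr.
rewrite !subSS !subn0 /=.
have := mul_bin_diag r.+2 t; have := mul_bin_down r.+1 t; rewrite /=.
move: 'C(r.+2, t.+1) 'C(r.+1, t) 'C(r, t) 'C(r.+3, t.+2) (turan_count _ _).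
move=> c b a D K ba bc KD h wD.
have cab : t.+3 * c <= r.+4 * (a + b).
  (* Up to the shift by 3 this is the side condition: it fails exactly when the original values
     satisfy [t = 3] and [6 <= r]. *)
  have rt : 2 * r.+1 <= t.+1 * r.+4 by nia.
  suff : t.+1 * (t.+3 * c) <= t.+1 * (r.+4 * (a + b)) by rewrite leq_pmul2l.
  have -> : t.+1 * (t.+3 * c) = t.+3 * (r.+2 * b) by rewrite bc; ring.
  have -> : t.+3 * (r.+2 * b) = t.+1 * r.+4 * b + 2 * ((r.+1 - t) * b).
    have [d ->] : exists d, r = t + d by exists (r - t); lia.
    have -> : (t + d).+1 - t = d.+1 by lia.
    ring.
  rewrite -ba; nia.
nia.
Qed.

(** * Counting cliques in the presence of nonadjacent pairs *)

Section Graph.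
Variables (V : finType) (e : rel V).

Definition nbhd v := [set u | e v u].
Definition cnbhd v := v |: nbhd v.
Definition cliques_in (B : {set V}) k :=
  [set S : {set V} | [&& S \subset B, is_clique e S & #|S| == k]].
Definition missing v :=
  [set P : {set V} | [&& P \subset nbhd v, #|P| == 2 & ~~ is_clique e P]].

Lemma is_cliqueP (S : {set V}) :
  reflect {in S &, forall x y, x != y -> e x y} (is_clique e S).
Proof.
apply: (iffP forall_inP) => [h x y xS yS xy|h x xS].
  by move/forall_inP: (h x xS) => /(_ y yS) /implyP; apply.
by apply/forall_inP => y yS; apply/implyP; apply: h.
Qed.

Lemma is_cliqueS (A B : {set V}) : A \subset B -> is_clique e B -> is_clique e A.
Proof.
move=> /subsetP AB /is_cliqueP cB; apply/is_cliqueP => x y xA yA.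
by apply: cB; apply: AB.
Qed.

(** Adding [P] is a bijection from the [(k - #|P|)]-subsets of [B :\: P] onto this family. *)
Lemma card_supersets (P B : {set V}) k : P \subset B -> #|P| <= k ->
  #|[set S : {set V} | [&& P \subset S, S \subset B & #|S| == k]]|
  = 'C(#|B| - #|P|, k - #|P|).
Proof.
move=> PB Pk; have <- : #|B :\: P| = #|B| - #|P| by rewrite cardsDS.
rewrite -cards_draws.
set X := LHS; rewrite -(card_in_imset (f := fun S => P :|: S)); last first.
  move=> S1 S2; rewrite !inE !subsetD => /andP[/andP[_ d1] _] /andP[/andP[_ d2] _].
  move/(congr1 (fun S => S :\: P)); rewrite !setDUl setDv !set0U.
  by rewrite !(setDidPl _).
apply: eq_card => S; rewrite !inE; apply/idP/imsetP.
  case/and3P=> PS SB /eqP Sk; exists (S :\: P).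
    by rewrite inE setSD //= cardsDS // Sk.
  by rewrite -[LHS](setID S P) (setIidPr PS).
case=> S'; rewrite inE subsetD => /andP[/andP[SB dS] /eqP cS] ->.
rewrite subsetUl subUset PB SB /= cardsU disjoint_setI0 1?disjoint_sym //.
by rewrite cards0 cS; apply/eqP; lia.
Qed.

Lemma card_cliques_in_le B k : #|cliques_in B k| <= 'C(#|B|, k).
Proof.
rewrite -cards_draws; apply/subset_leq_card/subsetP => S.
by rewrite !inE => /and3P[-> _ ->].
Qed.

Lemma cliques_in_missing1 (B P : {set V}) k :
  P \subset B -> #|P| = 2 -> ~~ is_clique e P -> 2 <= k ->
  #|cliques_in B k| + 'C(#|B| - 2, k - 2) <= 'C(#|B|, k).
Proof.
move=> PB P2 nP k2.
have := card_supersets P B k PB; rewrite P2 => /(_ k2) <-; rewrite -cards_draws.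
rewrite -cardsUI [X in _ + X](_ : _ = 0) ?addn0; last first.
  apply/eqP; rewrite cards_eq0 -subset0; apply/subsetP => S; rewrite !inE.
  case/andP=> /and3P[_ cS _] /and3P[PS _ _].
  by rewrite (is_cliqueS _ _ PS cS) in nP.
apply/subset_leq_card/subsetP => S; rewrite !inE.
by case/orP=> /and3P[? ? ?]; apply/andP.
Qed.

(** Pick [y] in [P] outside [Q]. The sets containing [P] and those containing [Q] but avoiding [y]
    are disjoint families of non-cliques; avoiding [y] turns [- 2] into [- 3]. *)
Lemma cliques_in_missing2 (B P Q : {set V}) k :
  P \subset B -> Q \subset B -> #|P| = 2 -> #|Q| = 2 -> P != Q ->
  ~~ is_clique e P -> ~~ is_clique e Q -> 2 <= k ->
  #|cliques_in B k| + 'C(#|B| - 2, k - 2) + 'C(#|B| - 3, k - 2) <= 'C(#|B|, k).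
Proof.
move=> PB QB P2 Q2 PQ nP nQ k2.
have [y yP yQ] : exists2 y, y \in P & y \notin Q.
  apply/subsetPn; apply: contra PQ => sPQ.
  by rewrite eqEcard sPQ P2 Q2.
have yB : y \in B by apply: (subsetP PB).
have QBy : Q \subset B :\ y by rewrite subsetD1 QB.
have -> : #|B| - 3 = #|B :\ y| - 2 by rewrite (cardsD1 y B) yB subSS.
have := card_supersets P B k PB; rewrite P2 => /(_ k2) <-.
have := card_supersets Q (B :\ y) k QBy; rewrite Q2 => /(_ k2) <-.
rewrite -cards_draws.
rewrite -[X in X + _]cardsUI [X in _ + X + _](_ : _ = 0) ?addn0; last first.
  apply/eqP; rewrite cards_eq0 -subset0; apply/subsetP => S; rewrite !inE.
  case/andP=> /and3P[_ cS _] /and3P[PS _ _].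
  by rewrite (is_cliqueS _ _ PS cS) in nP.
rewrite -cardsUI [X in _ + X](_ : _ = 0) ?addn0; last first.
  apply/eqP; rewrite cards_eq0 -subset0; apply/subsetP => S; rewrite !inE.
  case/andP=> /orP[/and3P[_ cS _]|/and3P[PS _ _]] /and3P[QS].
    by rewrite (is_cliqueS _ _ QS cS) in nQ.
  by rewrite subsetD1 (subsetP PS) // andbF.
apply/subset_leq_card/subsetP => S; rewrite !inE.
case/orP=> [/orP[]/and3P[? ? ?]|/and3P[_ + ?]]; try exact/andP.
by rewrite subsetD1 => /andP[? _]; apply/andP.
Qed.

(** Deleting [v] maps the [t]-cliques through [v] injectively to [(t-1)]-cliques of its
    neighbourhood. *)
Lemma double_count_cliques t : 0 < t ->
  t * k_t t e <= \sum_v #|cliques_in (nbhd v) t.-1|.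
Proof.
move=> t0.
have -> : t * k_t t e =
    \sum_v #|[set S in [set S : {set V} | is_clique e S && (#|S| == t)] | v \in S]|.
  under eq_bigr do rewrite -sum1dep_card big_mkcondr /=.
  rewrite exchange_big /= mulnC -sum_nat_const; apply: eq_bigr => S.
  by rewrite inE => /andP[_ /eqP<-]; rewrite -big_mkcond sum1_card.
apply: leq_sum => v _.
rewrite -(card_in_imset (f := fun S => S :\ v)); last first.
  move=> S1 S2; rewrite !inE => /andP[_ v1] /andP[_ v2] E.
  by rewrite -(setD1K v1) E setD1K.
apply/subset_leq_card/subsetP => ? /imsetP[S + ->]; rewrite !inE.
case/andP=> /andP[cS /eqP St] vS; apply/and3P; split.
- apply/subsetP => u; rewrite !inE => /andP[uv uS].
  by apply: (is_cliqueP _ cS); rewrite // eq_sym.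
- by apply: is_cliqueS cS; apply: subsetDl.
- by move: (cardsD1 v S); rewrite vS; lia.
Qed.

Lemma missing_pair v x y : x != y -> x \in nbhd v -> y \in nbhd v -> ~~ e x y ->
  [set x; y] \in missing v.
Proof.
move=> xy xv yv nxy; rewrite inE subUset !sub1set xv yv cards2 xy /=.
by apply: contra nxy => /is_cliqueP; apply; rewrite ?inE ?eqxx ?orbT.
Qed.

Lemma card_missing v :
  #|cliques_in (nbhd v) 2| + #|missing v| = 'C(#|nbhd v|, 2).
Proof.
rewrite -cards_draws -cardsUI [X in _ + X](_ : _ = 0) ?addn0; last first.
  apply/eqP; rewrite cards_eq0 -subset0; apply/subsetP => S; rewrite !inE.
  by case/andP=> /and3P[_ -> _] /and3P[_ _].
apply: eq_card => S; rewrite !inE.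
by case: (S \subset _) (is_clique e S) (_ == 2) => [] [] [].
Qed.

(** * Local structure under the degree and clique bounds *)

Variable r : nat.
Hypotheses (e_sym : symmetric e) (e_irr : irreflexive e).
Hypothesis deg_le : forall v, #|nbhd v| <= r.
Hypothesis clique_le : forall S : {set V}, is_clique e S -> #|S| <= r.

Lemma card_cnbhd v : #|cnbhd v| = #|nbhd v|.+1.
Proof. by rewrite cardsU1 inE e_irr. Qed.

Lemma missing_neq0 v : #|nbhd v| = r -> missing v != set0.
Proof.
move=> dv; apply/eqP => m0.
suff /clique_le : is_clique e (cnbhd v) by rewrite card_cnbhd dv ltnn.
apply/is_cliqueP => x y; rewrite !inE.
case/orP=> [/eqP->|xv]; case/orP=> [/eqP->|yv] xy //.
- by rewrite eqxx in xy.
- by rewrite e_sym.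
apply/negPn/negP => nxy.
suff : [set x; y] \in missing v by rewrite m0 inE.
by apply: missing_pair; rewrite ?inE.
Qed.

(** A vertex of [cnbhd v] in no missing pair acts as a twin of [v]: a nonneighbour there would form
    a missing pair with it. *)
Lemma twin_adj v c u : c \in cnbhd v -> c \notin cover (missing v) ->
  u \in cnbhd v -> u != c -> e c u.
Proof.
rewrite !inE => cv cm uv uc.
case/orP: cv => [/eqP cv|cv]; case/orP: uv => [/eqP uv|uv].
- by rewrite uv cv eqxx in uc.
- by rewrite cv.
- by rewrite uv e_sym.
apply/negPn/negP => ncu; case/negP: cm; apply/bigcupP.
exists [set c; u]; last by rewrite !inE eqxx.
by apply: missing_pair; rewrite ?inE // eq_sym.
Qed.

(** Such a twin has [r] neighbours inside [cnbhd v] already, so the degree bound leaves none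
    outside. *)
Lemma twin_closed v c u : #|nbhd v| = r ->
  c \in cnbhd v -> c \notin cover (missing v) -> e c u -> u \in cnbhd v.
Proof.
move=> dv cv cm cu.
have sub : cnbhd v :\ c \subset nbhd c.
  by apply/subsetP => w /setD1P[wc wv]; rewrite inE; apply: (twin_adj v).
have : cnbhd v :\ c == nbhd c.
  rewrite eqEcard sub; have := cardsD1 c (cnbhd v); rewrite cv card_cnbhd dv => E.
  by have := deg_le c; lia.
move/eqP/setP/(_ u); rewrite [RHS]inE cu => /setD1P[_ //].
Qed.

(** If [S] also has a vertex outside [cnbhd v], it contains no twin of [v], so it meets [cnbhd v]
    only in the missing pair [P]. A common vertex [a] is then adjacent to the [r - 1] vertices of
    [cnbhd v :\: P] and to the [t - 1 >= 2] other vertices of [S], more than [r] in all. *)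
Lemma cliques_confined v t S : 3 <= t -> #|nbhd v| = r -> #|missing v| = 1 ->
  is_clique e S -> #|S| = t -> ~~ [disjoint S & cnbhd v] -> S \subset cnbhd v.
Proof.
move=> t3 dv /eqP/cards1P[P mP] cS St.
have covP : cover (missing v) = P by rewrite mP /cover big_set1.
have : P \in missing v by rewrite mP set11.
rewrite inE => /and3P[Pv /eqP P2 _].
have PU : P \subset cnbhd v by rewrite (subset_trans Pv) ?subsetUr.
rewrite -setI_eq0 => /set0Pn[a /setIP[aS aU]].
apply/subsetP => p pS; apply/negPn/negP => pU.
have SP b : b \in S -> b \in cnbhd v -> b \in P.
  move=> bS bU; apply/negPn/negP => bP; case/negP: (pU).
  apply: (twin_closed _ b) => //; first by rewrite covP.
  apply: (is_cliqueP _ cS) => //; apply: contraNneq pU => <-; exact: bU.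
have : (cnbhd v :\: P) :|: (S :\ a) \subset nbhd a.
  apply/subsetP => c /setUP[/setDP[cU cP]|/setD1P[ca cS']].
    rewrite inE e_sym; apply: (twin_adj v); rewrite ?covP //.
    by apply: contraNneq cP => <-; apply: SP.
  by rewrite inE; apply: (is_cliqueP _ cS); rewrite // eq_sym.
move/subset_leq_card/leq_trans => /(_ _ (deg_le a)).
rewrite cardsU disjoint_setI0; last first.
  rewrite disjoint_subset; apply/subsetP => c /setDP[cU cP]; rewrite !inE.
  by apply: contra cP => /andP[_ cS']; apply: SP.
rewrite cards0 cardsDS // card_cnbhd dv P2.
by have := cardsD1 a S; rewrite aS St; move: #|_| t3; clear; lia.
Qed.

Lemma cliques_in_low_degree v k : #|nbhd v| < r ->
  #|cliques_in (nbhd v) k| <= 'C(r.-1, k).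
Proof.
move=> dv; apply: leq_trans (card_cliques_in_le _ _) _.
by apply: leq_bin2l; rewrite -ltnS (ltn_predK dv).
Qed.

(* The edges of [x] leaving the closed neighbourhood of [v] end in vertices with
   no neighbour among the at least [r - 3] twins of [v]. *)
Lemma missing2_rich v : 0 < r -> #|nbhd v| = r -> #|missing v| = 2 ->
  exists2 x, e v x & #|cliques_in (nbhd x) 2| + (r - 3) <= 'C(r, 2).
Proof.
move=> r0 dv /eqP/cards2P[P [Q [PQ mPQ]]].
have covPQ : cover (missing v) = P :|: Q.
  by rewrite mPQ /cover bigcup_setU !big_set1.
have : P \in missing v by rewrite mPQ !inE eqxx.
rewrite inE => /and3P[Pv /eqP P2 nP].
have : Q \in missing v by rewrite mPQ !inE eqxx orbT.
rewrite inE => /and3P[Qv /eqP Q2 _].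
have /cards2P[x [y [xy PE]]] : #|P| == 2 by apply/eqP.
have xP : x \in P by rewrite PE !inE eqxx.
have yP : y \in P by rewrite PE !inE eqxx orbT.
have xv : e v x by have := subsetP Pv x xP; rewrite inE.
have yv : e v y by have := subsetP Pv y yP; rewrite inE.
have nxy : ~~ e x y.
  apply: contra nP => exy; apply/is_cliqueP => a b; rewrite PE !inE.
  by do 2![case/orP=> /eqP->]; rewrite ?eqxx // e_sym.
exists x => //.
have [dx|dx] := ltnP #|nbhd x| r.
  have := cliques_in_low_degree x 2 dx; have := binS r.-1 1.
  by rewrite bin1 prednK //; move: #|_| 'C(r, 2) 'C(_, 2) => a b c; clear; lia.
have {}dx : #|nbhd x| = r by apply/eqP; rewrite eqn_leq deg_le.
(* Inside [cnbhd v], only the [r - 1] vertices other than [x] and [y] can be neighbours of [x]. *)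
have [p px pU] : exists2 p, p \in nbhd x & p \notin cnbhd v.
  apply/subsetPn; apply/negP => sxv.
  have : nbhd x \subset cnbhd v :\: P.
    rewrite subsetD sxv disjoint_sym PE disjoints_subset subUset !sub1set !inE.
    by rewrite e_irr nxy.
  move/subset_leq_card; rewrite cardsDS; last first.
    by rewrite (subset_trans Pv) ?subsetUr.
  by rewrite card_cnbhd dx dv P2 subSS subn1; case: (r) r0 => // n _; rewrite ltnn.
set C := cnbhd v :\: (P :|: Q).
have C3 : r - 3 <= #|C|.
  rewrite cardsDS ?card_cnbhd ?dv; last first.
    by rewrite subUset !(subset_trans _ (subsetUr _ _)).
  by rewrite cardsU P2 Q2; move: #|_|; clear; lia.
have Cp c : c \in C -> ~~ e c p.
  case/setDP=> cU cPQ; apply: contra pU; apply: (twin_closed _ c) => //.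
  by rewrite covPQ.
(* Each twin [c] in [C] is adjacent to [x] but not to [p], so [[set c; p]] is missing at [x]. *)
have : #|C| <= #|missing x|.
  rewrite -(card_in_imset (f := fun c => [set c; p])); last first.
    move=> a b /setDP[aU _] /setDP[bU _] /setP/(_ a).
    rewrite !inE eqxx /= => /esym/orP[/eqP //|/eqP ap].
    by rewrite -ap aU in pU.
  apply/subset_leq_card/subsetP => ? /imsetP[c cC ->].
  case/setDP: (cC) => cU cPQ; apply: missing_pair => //; last exact: Cp.
    by apply: contraNneq pU => <-.
  rewrite inE e_sym; apply: (twin_adj v); rewrite ?covPQ //.
    by rewrite !inE xv orbT.
  by apply: contraNneq cPQ => <-; rewrite inE xP.
by have := card_missing x; rewrite dx => <- ?; rewrite leq_add2l (leq_trans C3).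
Qed.

(** * Global bounds when no vertex of degree [r] has exactly one missing pair *)

Lemma sum_cliques_in t (S : {set V}) : 2 <= t ->
  (forall x y, e x y -> x \in S) ->
  t * k_t t e <= \sum_(v in S) #|cliques_in (nbhd v) t.-1|.
Proof.
move=> t2 supp; apply: leq_trans (double_count_cliques t _) _; first by lia.
rewrite (bigID (mem S)) /= [X in _ + X]big1 ?addn0 // => v vS.
(* Vertices outside [S] are isolated; since [t.-1] is positive, the empty clique is not counted. *)
have n0 : nbhd v = set0.
  by apply/setP => u; rewrite !inE; apply: contraNF vS => /supp.
apply/eqP; rewrite -leqn0 (leq_trans (card_cliques_in_le _ _)) //.
by rewrite n0 cards0 bin0n; case: t t2 => [|[]].
Qed.

Lemma missing_gt1 v : #|nbhd v| = r -> #|missing v| != 1 -> 1 < #|missing v|.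
Proof. by move=> dv; have := missing_neq0 v dv; rewrite -card_gt0; lia. Qed.

Lemma k_t_le_pointwise t (S : {set V}) : 3 <= t -> t <= r -> (4 <= t) || (r <= 5) ->
  (forall x y, e x y -> x \in S) ->
  (forall v, #|nbhd v| = r -> #|missing v| != 1) ->
  r.+1 * k_t t e <= #|S| * turan_count r t.
Proof.
move=> t3 tr tr' supp m1.
suff : t * (r.+1 * k_t t e) <= t * (#|S| * turan_count r t).
  by rewrite leq_pmul2l //; lia.
have := sum_cliques_in t S _ supp; move/(_ (ltnW t3)) => h.
rewrite mulnCA (leq_trans (leq_mul (leqnn _) h)) //.
rewrite mulnCA -sum_nat_const big_distrr /=; apply: leq_sum => v _.
have [dv|dv] := ltnP #|nbhd v| r.
  apply: leq_trans (low_degree_bound r t t3 tr).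
  by rewrite leq_mul2l cliques_in_low_degree ?orbT.
have {}dv : #|nbhd v| = r by apply/eqP; rewrite eqn_leq deg_le.
have /card_gt1P[P [Q [Pm Qm PQ]]] := missing_gt1 v dv (m1 v dv).
move: Pm Qm; rewrite !inE => /and3P[Pv /eqP P2 nP] /and3P[Qv /eqP Q2 nQ].
apply: two_missing_bound => //.
by rewrite -dv; apply: cliques_in_missing2 Pv Qv _ _ _ _ _ _ => //; lia.
Qed.

(* Charging: each vertex with exactly two missing pairs lies above the average but
   has a neighbour so far below it that it can pay for all its at most [r]
   neighbours. *)
Lemma k_3_le_discharging (S : {set V}) : 6 <= r ->
  (forall x y, e x y -> x \in S) ->
  (forall v, #|nbhd v| = r -> #|missing v| != 1) ->
  r.+1 * k_t 3 e <= #|S| * turan_count r 3.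
Proof.
move=> r6 supp m1.
pose w v := #|cliques_in (nbhd v) 2|.
have KE : 3 * turan_count r 3 + 3 * (r - 1) = r.+1 * 'C(r, 2).
  have := mul_turan_count r 3 isT; rewrite bin1 => <-; lia.
pose poor := [set v in S | (#|nbhd v| == r) && (#|missing v| == 2)].
pose rich := [set v in S | w v + (r - 3) <= 'C(r, 2)].
have poor_le : #|poor| <= r * #|rich|.
  have sub : poor \subset \bigcup_(x in rich) nbhd x.
    apply/subsetP => v; rewrite inE => /and3P[vS /eqP dv /eqP mv].
    have [|x vx wx] := missing2_rich v _ dv mv; first by lia.
    apply/bigcupP; exists x; last by rewrite inE e_sym.
    by rewrite inE wx (supp _ v) // e_sym.
  apply: leq_trans (subset_leq_card sub) _.
  apply: (@leq_trans (\sum_(x in rich) #|nbhd x|)).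
    elim/big_ind2: _ => [|n A m B An Bm|//]; first by rewrite cards0.
    by rewrite (leq_trans (leq_card_setU _ _)) ?leq_add.
  by rewrite mulnC -sum_nat_const leq_sum.
(* Call ['C(r, 2) - w v] the deficit. A deficit of 2 overshoots the scaled average by
   [3 * (r - 1) - 2 * r.+1 = r - 5], the amount a poor vertex receives. A deficit of [r - 3] lets a
   rich vertex pay exactly [r * (r - 5)]. *)
have local v : v \in S -> r.+1 * w v + r * (r - 5) * (v \in rich)
    <= 3 * turan_count r 3 + (r - 5) * (v \in poor).
  move=> vS; rewrite !inE vS /=.
  (* [k] is a lower bound on the deficit; [b] and [p] flag rich and poor. *)
  have bound k (b p : bool) : w v + k <= 'C(r, 2) ->
      r * (r - 5) * b + 3 * (r - 1) <= r.+1 * k + (r - 5) * p ->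
      r.+1 * w v + r * (r - 5) * b <= 3 * turan_count r 3 + (r - 5) * p.
    rewrite -(leq_pmul2l (ltn0Sn r)) mulnDr -KE.
    by move: (w v) (turan_count _ _) => x K; clear; lia.
  have [d rE] : exists d, r = d + 6 by exists (r - 6); lia.
  have r5 : r - 5 = d.+1 by lia.
  have r1 : r - 1 = d + 5 by lia.
  have r3 : r - 3 = d + 3 by lia.
  have [dv|dv] := ltnP #|nbhd v| r.
    apply: (bound (r - 1)).
      have := cliques_in_low_degree v 2 dv; rewrite -/(w v).
      have := binS r.-1 1; rewrite bin1 prednK; last by rewrite rE addnS.
      by move: (w v) 'C(r, 2) 'C(_, 2) => x y z; clear; lia.
    by case: (_ <= 'C(r, 2)); case: (_ && _); rewrite r5 r1 rE; clear; nia.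
  have {}dv : #|nbhd v| = r by apply/eqP; rewrite eqn_leq deg_le.
  have := card_missing v; rewrite dv eqxx -/(w v) /= => wm.
  have := missing_gt1 v dv (m1 v dv).
  case: (ltngtP 2 #|missing v|) => // [m3|m2] _; last first.
    rewrite -m2 in wm; rewrite -wm leq_add2l r3.
    have -> : (d + 3 <= 2) = false by clear; lia.
    by apply: (bound 2); rewrite ?wm // r5 r1 rE; clear; lia.
  case: (leqP _ 'C(r, 2)) => [wr|_].
    by apply: (bound (r - 3)) => //; rewrite r5 r1 r3 rE; clear; nia.
  apply: (bound 3); first by rewrite -wm leq_add2l.
  by rewrite r1 r5 rE; clear; nia.
suff : 3 * (r.+1 * k_t 3 e) <= 3 * (#|S| * turan_count r 3) by rewrite leq_pmul2l.
have := sum_cliques_in 3 S isT supp => /= h.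
have : \sum_(v in S) (r.+1 * w v + r * (r - 5) * (v \in rich))
    <= \sum_(v in S) (3 * turan_count r 3 + (r - 5) * (v \in poor)).
  exact: leq_sum.
have cnt (A : {set V}) : A \subset S -> \sum_(v in S) (v \in A : nat) = #|A|.
  move=> /subsetP AS; rewrite -big_mkcondr -sum1_card.
  by apply: eq_bigl => v; rewrite andb_idl //; apply: AS.
rewrite !big_split /= -!big_distrr /= !cnt ?sum_nat_const; first last.
- by apply/subsetP => v; rewrite inE => /andP[].
- by apply/subsetP => v; rewrite inE => /andP[].
move: (leq_mul (leqnn r.+1) h) (leq_mul (leqnn (r - 5)) poor_le).
move: (\sum_(_ in _) _) (k_t _ _) (turan_count _ _) #|S| #|rich| #|poor|.
clear; nia.
Qed.

End Graph.

Arguments nbhd {V}.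
Arguments cnbhd {V}.
Arguments cliques_in {V}.
Arguments missing {V}.

(** * Induction by deleting closed neighbourhoods *)

Lemma k_t_le (r t : nat) (V : finType) (e : rel V) (S : {set V}) :
  3 <= t -> t <= r -> symmetric e -> irreflexive e ->
  (forall v, #|nbhd e v| <= r) ->
  (forall A : {set V}, is_clique e A -> #|A| <= r) ->
  (forall x y, e x y -> x \in S) ->
  r.+1 * k_t t e <= #|S| * turan_count r t.
Proof.
move=> t3 tr; have [n] := ubnP #|S|.
elim: n e S => // n IH e S Sn e_sym e_irr deg_le clique_le supp.
have [/existsP[v /andP[/eqP dv /eqP mv]]|/existsPn h] :=
  boolP [exists v, (#|nbhd e v| == r) && (#|missing e v| == 1)]; last first.
  have m1 v : #|nbhd e v| = r -> #|missing e v| != 1.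
    by move=> dv; have := h v; rewrite dv eqxx.
  have [t4|[-> r6]] : (4 <= t) || (r <= 5) \/ t = 3 /\ 6 <= r.
    by move: t3; clear; lia.
  - exact: k_t_le_pointwise.
  - exact: k_3_le_discharging.
set U := cnbhd e v.
have cardU : #|U| = r.+1 by rewrite card_cnbhd ?dv.
have US : U \subset S.
  apply/subsetP => u; rewrite !inE => /orP[/eqP->|vu].
    have /card_gt0P[w] : 0 < #|nbhd e v| by rewrite dv; move: t3 tr; clear; lia.
    by rewrite inE => /supp.
  by apply: (supp u v); rewrite e_sym.
(* Deletion keeps the type [V]: edges meeting [U] are dropped, and the set [S] supporting all edges
   shrinks to [S :\: U]. *)
pose e' x y := [&& e x y, x \notin U & y \notin U].
have clique_e' A : is_clique e' A -> is_clique e A.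
  move/is_cliqueP => h; apply/is_cliqueP => x y xA yA xy.
  by have /and3P[] := h x y xA yA xy.
have : r.+1 * k_t t e' <= #|S :\: U| * turan_count r t.
  apply: IH.
  - rewrite cardsDS // cardU; move: Sn (subset_leq_card US); rewrite cardU.
    by clear; lia.
  - by move=> x y; rewrite /e' e_sym; congr (_ && _); rewrite andbC.
  - by move=> x; rewrite /e' e_irr.
  - move=> x; apply: leq_trans (deg_le x); apply/subset_leq_card/subsetP => u.
    by rewrite !inE => /and3P[].
  - by move=> A /clique_e'; apply: clique_le.
  - by move=> x y /and3P[/supp xS xU _]; rewrite inE xU.
have inU : #|cliques_in e U t| <= turan_count r t.
  have /eqP/cards1P[P mP] := mv.
  have : P \in missing e v by rewrite mP set11.
  rewrite inE => /and3P[Pv /eqP P2 nP].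
  have := cliques_in_missing1 V e U P t (subset_trans Pv (subsetUr _ _)) P2 nP.
  move/(_ (ltnW t3)); rewrite cardU /turan_count.
  by rewrite subSS subn1; move: #|_| => a; clear; lia.
(* A [t]-clique disjoint from [U] survives in [e']; any other lies inside [U] by confinement. *)
have : k_t t e <= k_t t e' + #|cliques_in e U t|.
  rewrite -cardsUI; apply: leq_trans (leq_addr _ _).
  apply/subset_leq_card/subsetP => A; rewrite !inE => /andP[cA At].
  rewrite cA At !andbT; apply/orP.
  have [dAU|dAU] := boolP [disjoint A & U]; [left | right].
    apply/is_cliqueP => x y xA yA xy.
    rewrite /e' (is_cliqueP _ _ _ cA) //.
    by rewrite !(disjointFr dAU).
  by apply: (cliques_confined V e r) cA (eqP At) dAU.
rewrite cardsDS // cardU.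
move: (subset_leq_card US) inU; rewrite cardU.
move: (k_t _ _) (k_t _ _) #|cliques_in _ _ _| (turan_count _ _) #|S| => a b c K s.
clear; nia.
Qed.

(** * The Turán graph and the extremal value *)

Lemma turan_relE r (i j : 'I_r.+1) : 1 < r ->
  turan_rel r.+1 r i j = (i != j) && ([set i; j] != [set ord0; ord_max]).
Proof.
move=> r1; rewrite /turan_rel; have [//|ij /=] := eqVneq i j.
(* Among [0, ..., r] only [0] and [r] share a residue modulo [r]. *)
have small (k : 'I_r.+1) : k %% r = if k == ord_max then 0 else k.
  case: eqP => [->|/eqP kr]; first by rewrite /= modnn.
  rewrite modn_small // ltn_neqAle -ltnS ltn_ord andbT.
  by apply: contra kr => /eqP kr; apply/eqP/val_inj.
have pairE (a b : 'I_r.+1) : a != b ->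
    [set a; b] = [set ord0; ord_max] ->
    (a == ord0) && (b == ord_max) || (a == ord_max) && (b == ord0).
  move=> ab /setP E; have := E a; have := E b; rewrite !inE !eqxx orbT /=.
  move: ab; case: (eqVneq a ord0) => [->|_]; case: (eqVneq b ord0) => [->|_] //=.
  - by move=> _ /esym ->.
  - by move=> _ _ /esym ->.
  by move=> + /esym/eqP bm /esym/eqP am; rewrite am bm eqxx.
congr (~~ _); apply/eqP/eqP => [E|/(pairE _ _ ij)].
  move: E; rewrite !small.
  case: (eqVneq i ord_max) ij => [->|im]; case: (eqVneq j ord_max) => [->|jm] ij //.
  - by move=> j0; rewrite setUC; congr [set _; _]; apply: val_inj.
  - by move=> i0; congr [set _; _]; apply: val_inj.
  - by move=> /val_inj E; rewrite E eqxx in ij.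
by case/orP=> /andP[/eqP-> /eqP->]; rewrite /= modnn mod0n.
Qed.

(** With [P] the only nonadjacent pair, the cliques are exactly the sets not containing [P]. *)
Lemma k_t_turan r t : 2 <= t -> 1 < r -> k_t t (turan_rel r.+1 r) = turan_count r t.
Proof.
move=> t2 r1; pose P : {set 'I_r.+1} := [set ord0; ord_max].
have P2 : #|P| = 2 by rewrite cards2 -val_eqE /= eq_sym -lt0n (ltnW r1).
have := card_supersets _ P [set: 'I_r.+1] t (subsetT _).
rewrite P2 cardsT card_ord => /(_ t2); rewrite subSS subn1 /turan_count => <-.
have cliqueE (S : {set 'I_r.+1}) : is_clique (turan_rel r.+1 r) S = ~~ (P \subset S).
  apply/is_cliqueP/idP => [cS|PS x y xS yS xy].
    apply/negP => /subsetP PS.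
    have := cS ord0 ord_max; rewrite !PS ?inE ?eqxx ?orbT // => /(_ isT isT).
    rewrite turan_relE // eqxx andbF -val_eqE /= eq_sym -lt0n (ltnW r1).
    by move/(_ isT).
  rewrite turan_relE // xy; apply: contra PS => /eqP xyP.
  by rewrite /P -xyP subUset !sub1set xS.
have -> : 'C(r.+1, t) = #|[set A : {set 'I_r.+1} | #|A| == t]|.
  by rewrite card_draws card_ord.
apply/eqP.
rewrite -(eqn_add2r #|[set S : {set 'I_r.+1} | [&& P \subset S, S \subset [set: _] & #|S| == t]]|).
rewrite subnK; last first.
  by apply/subset_leq_card/subsetP => S; rewrite !inE => /and3P[].
rewrite -cardsUI [X in _ + X](_ : _ = 0) ?addn0; last first.
  apply/eqP; rewrite cards_eq0 -subset0; apply/subsetP => S; rewrite !inE cliqueE.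
  by case: (P \subset S); rewrite ?andbF.
apply/eqP/eq_card => S; rewrite !inE cliqueE subsetT.
by case: (P \subset S) (#|S| == t) => [] [].
Qed.

Theorem mainTheorem10 (r t : nat) :
  3 <= t -> t <= r ->
  is_f_t t r r (rho_t t (turan_rel r.+1 r)) /\
  rho_t t (turan_rel r.+1 r) =
    ((r.+1)%:R^-1 * ('C(r.+1, t)%:R - 'C(r.-1, t - 2)%:R))%R.
Proof.
move=> t3 tr; have r1 : 1 < r by apply: leq_trans tr; apply: ltnW.
have kT := k_t_turan r t (ltnW t3) r1.
(* Lets the truncated subtraction in [turan_count] pass to the rationals. *)
have le_binom : 'C(r.-1, t - 2) <= 'C(r.+1, t).
  case: t t3 {tr kT} => [|[|t]] // _; case: r r1 => // r _; rewrite !subSS subn0 /=.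
  by rewrite binS [in X in _ + X]binS addnA leq_addl.
have rhoT : rho_t t (turan_rel r.+1 r) = ((turan_count r t)%:R / r.+1%:R)%R.
  by rewrite /rho_t kT card_ord.
split; last by rewrite rhoT mulrC natrB.
(* For leastness, the Turán graph itself is an admissible test graph. *)
split=> [V e [[e_sym e_irr] [/forallP deg /forallP cl]] V0|y]; last first.
  apply; last by rewrite card_ord.
  split; [split|split].
  - by move=> i j; rewrite !turan_relE // eq_sym setUC.
  - by move=> i; rewrite turan_relE // eqxx.
  - apply/forallP => i.
    have cardCi : #|predC1 i| = r by rewrite cardC1 card_ord.
    rewrite -[X in _ <= X]cardCi; apply/subset_leq_card/subsetP => j; rewrite !inE turan_relE //.
    by case/andP; rewrite eq_sym.
  - apply/forallP => S; apply/implyP => /is_cliqueP cS; rewrite -ltnS.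
    have cardT : #|[set: 'I_r.+1]| = r.+1 by rewrite cardsT card_ord.
    rewrite -[X in _ < X]cardT; apply: proper_card; rewrite properT; apply/negP => /eqP ST.
    have := cS ord0 ord_max; rewrite ST !inE => /(_ isT isT).
    rewrite turan_relE // eqxx andbF -val_eqE /= eq_sym -lt0n (ltnW r1).
    by move/(_ isT).
rewrite rhoT /rho_t ler_pdivrMr ?ltr0n // mulrAC ler_pdivlMr ?ltr0n //.
rewrite -!natrM ler_nat mulnC [X in _ <= X]mulnC -cardsT.
(* Here the supporting set is all of [V]. *)
apply: k_t_le => // A.
by apply/implyP; apply: cl.
Qed.
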